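(* If $c$ is a code word of $\mathcal{C}_{j,k}(n,q)$, with \[ \textnormal{wt}(c) \leq \frac{2q^k}{\theta_j} \binom{k}{j}_q, \] then $c = \alpha \kappa$, for some $\alpha \in \mathbb F_p$, and $\kappa$ a $k$-space of $\mathrm{PG}(n,q)$. As a consequence, the minimum weight of $\mathcal{H}_{j,k}(n,q)$ is larger than $2q^k \binom{k}{j}_q / \theta_j$.
   Context: Let $p$ be prime, $q=p^h$ any prime power, and $0 \le j < k < n$ integers. Let $G_j$ be the set of $j$-spaces of $\mathrm{PG}(n,q)$ and $V(j,n,q)=\mathbb F_p^{G_j}$. A $k$-space $\kappa$ is identified with the function in $V(j,n,q)$ taking value $1$ on the $j$-spaces contained in $\kappa$ and $0$ elsewhere. $\mathcal{C}_{j,k}(n,q)$ is the subspace of $V(j,n,q)$ spanned by all $k$-spaces (the $p$-ary row span of the incidence matrix of $k$-spaces versus $j$-spaces). The dual is taken w.r.t. the standard scalar product $v\cdot w=\sum_{\lambda\in G_j} v(\lambda)w(\lambda)$, and the hull is $\mathcal{H}_{j,k}(n,q) := \mathcal{C}_{j,k}(n,q) \cap \mathcal{C}_{j,n-k+j}(n,q)^\perp$. $\textnormal{wt}(c)$ is the number of $j$-spaces with nonzero value. The Gaussian coefficient $\binom{m+1}{j+1}_q = \frac{(q^{m+1}-1)(q^m-1)\cdots(q^{m-j+1}-1)}{(q^{j+1}-1)(q^j-1)\cdots(q-1)}$, with $\binom{m+1}{0}_q=1$, and $\theta_m = \binom{m+1}{1}_q = \frac{q^{m+1}-1}{q-1}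$.
   Formalization: For j = 0 the claim fails at equality (the difference of two k-spaces meeting in a (k-1)-space has weight 2q^k and lies in the hull), so for j = 0 it is proved for wt(c) < 2q^k, and the hull's minimum weight is at least 2q^k; for j ≥ 1 it is as printed. *)

(* Defs.v *)
From HB Require Import structures.
From mathcomp Require Import all_boot all_order all_algebra.

Set Implicit Arguments.
Unset Strict Implicit.
Unset Printing Implicit Defensive.

Import Order.TTheory GRing.Theory Num.Theory.
Local Open Scope ring_scope.

Section FiniteVspace.

Import VectorInternalTheory.

HB.instance Definition _ (F : finFieldType) (vT : vectType F) :=
  [Countable of {vspace vT} by <:].
HB.instance Definition _ (F : finFieldType) (vT : vectType F) :=
  [Finite of {vspace vT} by <:].

End FiniteVspace.

(* PG(n, q) is the projective space of F^(n+1) with #|F| = q: a j-space, of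
   projective dimension j, is a vector subspace of dimension j + 1. *)
Definition pgspace (F : finFieldType) (n j : nat) : predArgType :=
  {U : {vspace 'rV[F]_n.+1} | \dim U == j.+1}.

HB.instance Definition _ F n j := SubFinite.on (pgspace F n j).

(* The ambient space V(j, n, q). The regular module ('F_p)^o is 'F_p seen as a
   vector space over itself. *)
Definition words (p : nat) (F : finFieldType) (n j : nat) :=
  {ffun pgspace F n j -> ('F_p)^o}.

HB.instance Definition _ p F n j := Vector.on (words p F n j).
HB.instance Definition _ p F n j := Finite.on (words p F n j).

Section Codes.

Variables (p : nat) (F : finFieldType) (n j : nat).

Definition space_word (k : nat) (kappa : pgspace F n k) : words p F n j :=
  [ffun lambda : pgspace F n j => (val lambda <= val kappa)%VS%:R].

Definition code (k : nat) : {vspace words p F n j} :=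
  <<[seq space_word kappa | kappa : pgspace F n k]>>%VS.

Definition dotw (v w : words p F n j) : 'F_p :=
  \sum_(lambda : pgspace F n j) v lambda * w lambda.

Definition dual (C : {set words p F n j}) : {set words p F n j} :=
  [set v | [forall w in C, dotw v w == 0]].

Definition hull (k : nat) : {set words p F n j} :=
  [set c in code k] :&: dual [set c in code (n - k + j)].

Definition wt (c : words p F n j) : nat :=
  #|[set lambda | c lambda != 0]|.

(* The minimum of the weights of the nonzero words of C. The default value
   #|pgspace F n j| bounds every weight, so it only matters when C has no
   nonzero word. *)
Definition min_weight (C : {set words p F n j}) : nat :=
  \big[minn/#|pgspace F n j|]_(c in C | c != 0) wt c.

End Codes.

(* For b <= a, the Gaussian coefficient of a and b in base q; the products are
   empty, and the value 1, when b = 0. *)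
Definition gauss (q a b : nat) : rat :=
  (\prod_(i < b) (q%:R ^+ (a - i) - 1)) / (\prod_(i < b) (q%:R ^+ (b - i) - 1)).

Definition theta (q m : nat) : rat := gauss q m.+1 1.

(* For j = 0 this is 2 q^k, the weight of the difference of two k-spaces that
   share a (k - 1)-space. That difference is a nonzero word of the hull and not
   a multiple of a k-space, so for j = 0 the characterisation only holds below
   the bound, and the minimum weight of the hull is not larger than it. For
   j > 0 the bound itself is included. *)
Definition weight_bound (q j k : nat) : rat :=
  2 * q%:R ^+ k / theta q j * gauss q k j.

(* Main.v *)
Require Import Defs.
From mathcomp Require Import all_boot all_order all_algebra all_field.
From mathcomp Require Import zify ring.

Set Implicit Arguments.
Unset Strict Implicit.
Unset Printing Implicit Defensive.

Import Order.TTheory GRing.Theory Num.Theory.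
Local Open Scope ring_scope.

(* Extending scalars from F_p to F, a word of C_{0,k}(n, q) becomes a sum phi of
   multiples of indicator functions of (k + 1)-dimensional subspaces of
   F^(n + 1), and its weight counts nonzero vectors of the support in multiples
   of q - 1.

   For hyperplanes, phi = phi(0) - (sum of (q - 1)-st powers of linear forms).
   If phi(e) = phi(0), the polynomial t |-> phi(v + t e) has degree at most
   q - 2, and a Schwartz-Zippel count shows that a phi of weight below 2 q^k is
   invariant under translation by e. So {phi = phi(0)} is a subspace K, and
   counting along lines through a zero of phi outside K forces phi to be a
   multiple of the indicator of K. In codimension c > 1, summing phi along the
   lines in a direction r lowers the codimension by one, and a direction r that
   avoids the relevant differences shows that the support is closed under
   addition.

   For j > 0, every subspace M of dimension j gives such a phi, whose value at v
   outside M is the value of c at <M, v>. Counting the j-spaces of the support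
   through subspaces of smaller and smaller dimension bounds the number of
   points on the support by 2 q^k; hence each phi is a multiple of one
   (k + 1)-dimensional subspace, and all these subspaces coincide. *)

(** * Power sums of linear forms *)

Section PowerSums.

Variables (F : finFieldType) (N : nat).
Local Notation V := 'rV[F]_N.
Local Notation q := #|F|.

Definition power_sum (s : seq (F * 'cV[F]_N)) (r : nat) (v : V) : F :=
  \sum_(x <- s) x.1 * (v *m x.2) 0 0 ^+ r.

(** By the binomial theorem, the power sum of degree [r - i] with these coefficients is the
    coefficient of t^i in [power_sum s r (v + t *: e)]. *)
Definition shift_coef (s : seq (F * 'cV[F]_N)) (e : V) (r i : nat) :=
  [seq (x.1 * ((e *m x.2) 0 0 ^+ i *+ 'C(r, i)), x.2) | x <- s].

Lemma power_sum_shift s r v e t :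
  power_sum s r (v + t *: e) =
  \sum_(i < r.+1) power_sum (shift_coef s e r i) (r - i) v * t ^+ i.
Proof.
rewrite /power_sum.
under [RHS]eq_bigr => i _ do rewrite big_map big_distrl /=.
rewrite exchange_big /=; apply: eq_bigr => x _.
rewrite mulmxDl -scalemxAl !mxE exprDn big_distrr /=; apply: eq_bigr => i _.
by rewrite exprMn -mulrnAr -mulrnAr; ring.
Qed.

(** For each fixed t, translation by t e permutes the space, so every vector of [f] is counted q
    times. *)
Lemma sum_card_line (f : pred V) (e : V) :
  (\sum_(v : V) #|[pred t : F | f (v + t *: e)%R]| = q * #|f|)%N.
Proof.
under eq_bigr => v _ do rewrite -sum1_card big_mkcond.
rewrite exchange_big /= -sum_nat_const; apply: eq_big => // t _.
rewrite -sum1_card [RHS]big_mkcond /= (reindex_inj (addIr (- (t *: e)))) /=.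
by apply: eq_bigr => v _; rewrite inE /= subrK.
Qed.

Lemma card_roots_le (D : nat) (g : nat -> F) : g D != 0 -> (D < q)%N ->
  (q - D <= #|[pred t : F | (\sum_(i < D.+1) g i * t ^+ i != 0)%R]|)%N.
Proof.
move=> gD Dq; pose P := \poly_(i < D.+1) g i.
have sP : size P = D.+1 by rewrite size_poly_eq.
have P0 : P != 0 by rewrite -size_poly_eq0 sP.
have := max_poly_roots P0 (_ : all (root P) (enum [pred t | root P t])).
rewrite enum_uniq sP -cardE ltnS => /(_ _ isT) H.
have {}H : (#|[pred t | root P t]| <= D)%N.
  by apply: H; apply/allP => t; rewrite mem_enum.
have := cardC [pred t | root P t]; rewrite [X in _ = X -> _](_ : _ = q) // => HC.
have -> : #|[pred t : F | \sum_(i < D.+1) g i * t ^+ i != 0]|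
          = #|[predC [pred t | root P t]]|.
  by apply: eq_card => t; rewrite !inE /= rootE horner_poly.
by rewrite -HC leq_subLR leq_add2r.
Qed.

(** Let D be the largest index whose coefficient is not identically zero; it is positive because [f]
    changes along [e]. Wherever [g D v != 0], at most D parameters t give a zero of [f] on the line
    through v; summing over v gives the count. *)
Lemma shift_nonzeros (f : V -> F) (e : V) (r : nat) (g : nat -> V -> F) :
  (r < q)%N ->
  (forall v t, f (v + t *: e) = \sum_(i < r.+1) g i v * t ^+ i) ->
  (exists v, f (v + e) != f v) ->
  exists D, [/\ (0 < D <= r)%N, exists v, g D v != 0 &
    ((q - D) * #|[pred v | (g D v != 0)%R]| <= q * #|[pred v | (f v != 0)%R]|)%N].
Proof.
move=> rq fE [v0 fv0].
pose P i := (0 < i <= r)%N && [exists v, g i v != 0].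
have exP : exists i, P i.
  (* Without such an index, f (v0 + t e) would not depend on t and would agree at t = 0 and t =
     1. *)
  suff /existsP[i Pi] : [exists i : 'I_r.+1, P i] by exists i.
  apply: contraNT fv0 => /existsPn nP; apply/eqP.
  have := fE v0 1; have := fE v0 0; rewrite scale1r scale0r addr0 => -> ->.
  rewrite !big_ord_recl !expr0; congr (_ + _); apply: eq_bigr => i _.
  rewrite (_ : g _ _ = 0) ?mul0r //; apply/eqP.
  have := nP (lift ord0 i); rewrite /P /= -[bump 0 i]/(i.+1) ltn_ord /= => /existsPn/(_ v0).
  by rewrite negbK.
have ubP i : P i -> (i <= r)%N by case/andP => /andP[].
case: (ex_maxnP exP ubP) => D /andP[/andP[D0 Dr] /existsP gD] Dmax.
exists D; split=> //; first by rewrite D0.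
have fE' v t : f (v + t *: e) = \sum_(i < D.+1) g i v * t ^+ i.
  rewrite fE (@big_ord_widen _ _ _ D.+1 r.+1 (fun i => g i v * t ^+ i)) //.
  rewrite [RHS]big_mkcond; apply: eq_bigr => i _; case: ltnP => //= Di.
  rewrite (_ : g i v = 0) ?mul0r //; apply/eqP/negPn/negP => giv.
  suff /Dmax : P i by rewrite leqNgt Di.
  rewrite /P (leq_trans _ Di) //= -ltnS ltn_ord /=.
  by apply/existsP; exists v.
rewrite -(sum_card_line [pred v | f v != 0] e) mulnC -sum_nat_const big_mkcond.
apply: leq_sum => v _; case: ifP => // gDv.
apply: leq_trans (card_roots_le (g := g^~ v) gDv (leq_ltn_trans Dr rq)) _.
by apply: subset_leq_card; apply/subsetP => t; rewrite !inE /= fE'.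
Qed.

(* A Schwartz-Zippel bound; the induction differentiates in a direction along
   which the power sum is not constant. *)
Lemma power_sum_nonzeros s r : (r < q)%N -> (exists v, power_sum s r v != 0) ->
  ((q - r) * q ^ N <= q * #|[pred v | (power_sum s r v != 0)%R]|)%N.
Proof.
have [m] := ubnP r; elim: m => // m IH in r s * => rm rq [v0 nz].
have cV : #|{: V}| = (q ^ N)%N by rewrite card_mx mul1n.
(* A power sum invariant under all translations is a nonzero constant and has no zeros. *)
have [/forallP inv|] := boolP [forall e, [forall v, power_sum s r (v + e) == power_sum s r v]].
  suff -> : #|[pred v | power_sum s r v != 0]| = (q ^ N)%N.
    by rewrite leq_mul2r leq_subr orbT.
  rewrite -cV; apply: eq_card => v; rewrite !inE /=.
  by have /forallP/(_ v0)/eqP := inv (v - v0); rewrite addrC subrK => ->.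
move/forallPn=> [e /forallPn nI].
case: (@shift_nonzeros _ e r (fun i => power_sum (shift_coef s e r i) (r - i)) rq
  (fun v t => power_sum_shift s r v e t) nI) => D [/andP[D0 Dr] gD le].
have h0 : (r - D < m)%N by lia.
have h0' : (r - D < q)%N by lia.
have le2 := IH _ _ h0 h0' gD.
have q0 : (0 < q)%N by lia.
rewrite -(leq_pmul2l q0).
move: le le2; rewrite /=; set A := #|[pred v | power_sum (shift_coef _ _ _ _) _ v != 0]|.
set B := #|[pred v | power_sum s r v != 0]|; set X := (q ^ N)%N.
move: (q) rq q0 => Q rQ Q0 le le2.
(* The right side exceeds the left by D (r - D). *)
have h3 : ((Q - r) * Q <= (Q - D) * (Q - (r - D)))%N.
  have -> : (Q - D = (Q - r) + (r - D))%N by lia.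
  have -> : (Q - (r - D) = (Q - r) + D)%N by lia.
  have -> : (((Q - r) * Q) = ((Q - r) * ((Q - r) + (r - D) + D)))%N by congr (_ * _)%N; lia.
  rewrite !mulnDl !mulnDr; set a := (Q - r)%N; set b := (r - D)%N.
  by rewrite (mulnC b a) -!addnA leq_add2l addnCA !addnA leq_addr.
apply: (@leq_trans ((Q - D) * (Q - (r - D)) * X)).
  by rewrite mulnA leq_mul2r (mulnC Q) h3 orbT.
rewrite -mulnA; apply: (@leq_trans ((Q - D) * (Q * A))); first by rewrite leq_mul2l le2 orbT.
by rewrite mulnCA leq_mul2l le orbT.
Qed.

End PowerSums.

(** * Sums of indicator functions of subspaces *)

(** The cokernel of [B] has rank c, and its column base has the same left kernel, since the row base
    that completes the factorisation is row free. *)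
Lemma kernel_matrix (F : fieldType) (m N c : nat) (B : 'M[F]_(m, N)) :
  (\rank B + c = N)%N ->
  exists A : 'M[F]_(N, c), forall v : 'rV_N, (v *m A == 0) = (v <= B)%MS.
Proof.
move=> rB; have rc : \rank (cokermx B) = c by rewrite mxrank_coker; lia.
pose A := col_base (cokermx B).
have EA (v : 'rV_N) : (v *m A == 0) = (v <= B)%MS.
  have E : v *m cokermx B = v *m A *m row_base (cokermx B).
    by rewrite -mulmxA mulmx_base.
  rewrite submxE E; apply/eqP/eqP => [->|H]; first by rewrite mul0mx.
  by apply: (row_free_inj (row_base_free (cokermx B))); rewrite mul0mx.
by move: A EA; rewrite rc => A EA; exists A.
Qed.

Section SubspaceSums.

Variables (F : finFieldType) (N : nat).
Local Notation V := 'rV[F]_N.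
Local Notation q := #|F|.

Lemma vspace_of_closed (K : pred V) : K 0 ->
  (forall u v, K u -> K v -> K (u + v)) -> (forall t v, K v -> K (t *: v)) ->
  exists U : {vspace V}, forall v, (v \in U) = K v.
Proof.
move=> K0 KD KZ; exists <<enum K>>%VS => v; apply/idP/idP => [|Kv].
  move/coord_span->; elim/big_ind: _ => // i _; apply: KZ.
  by rewrite -[K _]/(_ \in K) -mem_enum; apply: mem_nth; rewrite -cardE.
by apply: memv_span; rewrite mem_enum.
Qed.

Lemma card_rV : #|{: V}| = (q ^ N)%N.
Proof. by rewrite card_mx mul1n. Qed.

(* The kernel of a matrix with c columns has codimension at most c. *)
Definition subspace_sum (c : nat) (s : seq (F * 'M[F]_(N, c))) (v : V) : F :=
  \sum_(x <- s) x.1 * (v *m x.2 == 0)%:R.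

(* Weights count vectors, not points: a word of weight w on the points gives a
   function of weight (q - 1) w. *)
Definition weight (f : V -> F) : nat := #|[pred v | (v != 0) && (f v != 0)]|.

Lemma subspace_sumZ c (s : seq (F * 'M[F]_(N, c))) t v : t != 0 ->
  subspace_sum s (t *: v) = subspace_sum s v.
Proof.
by move=> t0; apply: eq_bigr => x _; rewrite -scalemxAl scaler_eq0 (negPf t0).
Qed.

Lemma card_le_weight (f : V -> F) : (#|[pred v | (f v != 0)%R]| <= (weight f).+1)%N.
Proof.
by rewrite (cardD1 0) -[(weight f).+1]add1n leq_add ?leq_b1.
Qed.

Lemma sum_delta (P : pred F) t0 : (forall t, P t = (t == t0)) ->
  \sum_t (P t)%:R = 1 :> F.
Proof.
move=> PE; rewrite (bigD1 t0) //= PE eqxx big1 ?addr0 // => t /negPf.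
by rewrite PE => ->.
Qed.

Lemma card_eq0 : q%:R = 0 :> F.
Proof.
have E : \sum_(t : F) t = \sum_(t : F) (t + 1) by rewrite (reindex_inj (addIr 1)).
by move: E; rewrite big_split /= sumr_const -[LHS]addr0 => /addrI.
Qed.

(** A term whose kernel contains [r] is constant along the line and contributes q = 0 in F. For any
    other term, exactly one t reaches the kernel if v lies in the kernel plus the line of [r], and
    none otherwise. *)
Lemma sum_line c (s : seq (F * 'M[F]_(N, c))) v r :
  \sum_t subspace_sum s (v + t *: r) =
  \sum_(x <- s) x.1 * ((r *m x.2 != 0) && (v *m x.2 <= r *m x.2)%MS)%:R.
Proof.
rewrite exchange_big; apply: eq_bigr => x _; rewrite -big_distrr /=; congr (_ * _).
under eq_bigr => t _ do rewrite mulmxDl -scalemxAl addr_eq0.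
have [->|r0] := eqVneq (r *m x.2) 0.
  under eq_bigr => t _ do rewrite scaler0 oppr0.
  by rewrite sumr_const -[_ *+ #|_|]mulr_natr card_eq0 mulr0.
case: sub_rVP => /= [[a ->]|ne].
  rewrite (@sum_delta (fun t => _) (- a)) // => t.
  rewrite -scaleNr -subr_eq0 -scalerBl scaler_eq0 (negPf r0) orbF subr_eq0.
  by rewrite eq_sym eqr_oppLR.
rewrite big1 // => t _; case: eqP => // E; case: ne.
by exists (- t); rewrite E scaleNr.
Qed.

(** Terms whose kernel contains [r] disappear; each other kernel is enlarged by [r], so one column
    less suffices. *)
Lemma sum_line_subspace c (s : seq (F * 'M[F]_(N, c.+2))) r :
  exists s' : seq (F * 'M[F]_(N, c.+1)),
    forall v, \sum_t subspace_sum s (v + t *: r) = subspace_sum s' v.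
Proof.
elim: s => [|x s [s' IH]].
  by exists [::] => v; rewrite sum_line /subspace_sum !big_nil.
have [rx|rx] := eqVneq (r *m x.2) 0.
  by exists s' => v; rewrite -IH !sum_line big_cons rx eqxx mulr0 add0r.
have [|A EA] := @kernel_matrix F 1 c.+2 c.+1 (r *m x.2).
  by rewrite rank_rV rx.
exists ((x.1, x.2 *m A) :: s') => v.
rewrite sum_line big_cons -sum_line IH /subspace_sum big_cons rx /=.
by rewrite mulmxA EA.
Qed.

(** A line whose direction is outside a hyperplane always meets it exactly once, so the sum does not
    depend on [v]. *)
Lemma sum_line_hyperplane (s : seq (F * 'M[F]_(N, 1))) v r :
  \sum_t subspace_sum s (v + t *: r) = subspace_sum s 0 - subspace_sum s r.
Proof.
rewrite sum_line /subspace_sum -sumrB; apply: eq_bigr => x _.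
rewrite mul0mx eqxx mulr1; have [rx|rx] := eqVneq; first by rewrite !mulr1 mulr0 subrr.
rewrite mulr0 subr0 /= (_ : (_ <= _)%MS) ?mulr1 //.
by rewrite submx_full // /row_full rank_rV rx.
Qed.

(** The indicator of a = 0 is 1 - a^(q-1). *)
Lemma hyperplane_power_sum (s : seq (F * 'cV[F]_N)) v :
  subspace_sum s v = subspace_sum s 0 - power_sum s q.-1 v.
Proof.
rewrite /subspace_sum /power_sum -sumrB; apply: eq_bigr => x _.
rewrite mul0mx eqxx -mulrBr; congr (_ * _).
have -> : (v *m x.2 == 0) = ((v *m x.2) 0 0 == 0).
  apply/eqP/eqP => [->|E]; first by rewrite mxE.
  by apply/matrixP => i j; rewrite !ord1 E mxE.
set a := (v *m x.2) 0 0.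
have [->|a0] := eqVneq a 0.
  by rewrite expr0n -subn1 subn_eq0 leqNgt finNzRing_gt1 subr0.
apply/esym/eqP; rewrite subr_eq0 eq_sym -(inj_eq (mulfI a0)) mulr1 -exprS.
by rewrite prednK ?expf_card // (ltn_trans _ (finNzRing_gt1 F)).
Qed.

End SubspaceSums.

(** * Sums of small weight are multiples of one subspace *)

Section SmallSubspaceSums.

Variable F : finFieldType.
Local Notation q := #|F|.

Lemma card_rV_vspace N (U : {vspace 'rV[F]_N}) : #|U| = (q ^ \dim U)%N.
Proof. exact: card_vspace. Qed.

Lemma dim_add_line N (U : {vspace 'rV[F]_N}) v : v \notin U ->
  \dim (U + <[v]>)%VS = (\dim U).+1.
Proof.
move=> vU; have v0 : v != 0 by apply: contraNneq vU => ->; rewrite mem0v.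
rewrite dimv_disjoint_sum ?dim_vline ?v0 ?addn1 //.
apply/eqP; rewrite -subv0; apply/subvP => x; rewrite memv_cap memv0.
case/andP => xU /vlineP[t xE]; rewrite xE scaler_eq0 (negPf v0) orbF.
apply: contraNT vU => t0; rewrite -[v]scale1r -(mulVf t0) -scalerA -xE.
exact: memvZ.
Qed.

Lemma card_add_line N (U : {vspace 'rV[F]_N}) v : v \notin U ->
  #|(U + <[v]>)%VS| = (q * #|U|)%N.
Proof. by move=> vU; rewrite !card_rV_vspace dim_add_line // expnS. Qed.

Lemma card_vspaceC N (U : {vspace 'rV[F]_N}) :
  (#|U| + #|[pred v : 'rV[F]_N | v \notin U]| = q ^ N)%N.
Proof. by rewrite -(card_rV F N) -(cardC (mem U)); congr (_ + _)%N; apply: eq_card. Qed.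

(** * Codimension one *)

Section Hyperplanes.

Variables (k : nat) (s : seq (F * 'cV[F]_k.+2)).
Local Notation f := (subspace_sum s).
(** Since [f] is invariant under nonzero scalars, its weight is a multiple of q - 1, and the bound
    says that the support has fewer than 2 q^k points. *)
Hypothesis wf : (weight f + (q - 1) <= 2 * q ^ k * (q - 1))%N.

(** Otherwise [f] has some degree D in t along [e], with 1 <= D <= q - 2. The leading coefficient is
    a power sum of degree q - 1 - D, so it has at least (D + 1) q^(k+1) nonzeros, and [f] at least
    (q - D) (D + 1) q^k, which is too many. *)
Lemma hyperplane_sum_shift e v : f e = f 0 -> f (v + e) = f v.
Proof.
move=> fe; apply/eqP/negPn/negP => nv.
have q1 : (1 < q)%N := finNzRing_gt1 F.
(* The constant coefficient is [f] itself, which absorbs the term f(0); the others are negated power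
   sums. *)
pose g i v := if i == 0%N then f v
              else - power_sum (shift_coef s e q.-1 i) (q.-1 - i) v.
have fE u t : f (u + t *: e) = \sum_(i < q.-1.+1) g i u * t ^+ i.
  rewrite hyperplane_power_sum power_sum_shift !big_ord_recl /=.
  rewrite expr0 !mulr1 opprD addrA; congr (_ + _).
    rewrite /g /= (hyperplane_power_sum s u); congr (_ - _).
    rewrite subn0 /power_sum big_map; apply: eq_bigr => x _.
    by rewrite expr0 bin0 mulr1.
  by rewrite -sumrN; apply: eq_bigr => i _; rewrite /g /= mulNr.
have qq : (q.-1 < q)%N by lia.
have [D [/andP[D0 Dr] [u gDu] le]] := @shift_nonzeros F _ f e q.-1 g qq fE (ex_intro _ v nv).
(* The coefficient of t^(q-1) is f(e) - f(0), which vanishes. *)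
have Dq : (D < q.-1)%N.
  rewrite ltn_neqAle Dr andbT; apply: contraNneq gDu => DE.
  rewrite /g -DE eqn0Ngt D0 /= DE subnn oppr_eq0.
  suff -> : power_sum (shift_coef s e q.-1 q.-1) 0 u = power_sum s q.-1 e.
    by have := hyperplane_power_sum s e; rewrite fe -[LHS]subr0 => /addrI/oppr_inj <-.
  by rewrite /power_sum big_map; apply: eq_bigr => x _; rewrite expr0 mulr1 binn.
have gDE w : (g D w != 0) = (power_sum (shift_coef s e q.-1 D) (q.-1 - D) w != 0).
  by rewrite /g eqn0Ngt D0 /= oppr_eq0.
have := @power_sum_nonzeros F _ (shift_coef s e q.-1 D) (q.-1 - D) _ (ex_intro _ u _).
rewrite -gDE => /(_ _ gDu); rewrite (leq_ltn_trans (leq_subr _ _) qq) => /(_ isT).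
rewrite -(eq_card (A := [pred w | g D w != 0])) => [le2|w]; last by rewrite !inE gDE.
have := card_le_weight f.
move: le le2; set G := #|[pred w | g D w != 0]|; set A := #|[pred w | f w != 0]|.
move: wf; set W := weight f; move: (q) D0 Dq q1 => Q D0 DQ Q1 HW le le2 AW.
have X0 : (0 < Q ^ k)%N by rewrite expn_gt0; lia.
move: X0 HW le2; rewrite !expnS; set X := (Q ^ k)%N => X0 HW le2.
have [b bE] : exists b, Q = (D + b + 2)%N by exists (Q - D - 2)%N; lia.
rewrite (_ : Q - (Q.-1 - D) = D + 1)%N in le2; last by lia.
rewrite (_ : Q - D = b + 2)%N in le; last by lia.
rewrite (_ : Q - 1 = D + b + 1)%N in HW; last by lia.
have {}le2 : ((D + 1) * Q * X <= G)%N.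
  by rewrite -(@leq_pmul2l Q) ?(ltnW Q1) //; apply: leq_trans le2; lia.
have le3 : ((b + 2) * (D + 1) * X <= A)%N.
  rewrite -(@leq_pmul2l Q) ?(ltnW Q1) //; apply: leq_trans le.
  by apply: leq_trans (leq_mul (leqnn (b + 2)%N) le2); lia.
(* Here b = q - D - 2, and (q - D) (D + 1) exceeds 2 (q - 1) by b (D - 1). *)
have : (b * 1 * X <= b * D * X)%N by rewrite leq_mul2r leq_mul2l D0 !orbT.
lia.
Qed.

(** A single nonzero value would equal the sum, and no nonzero value would make the sum zero. *)
Lemma two_le_card (A : pred F) (h : F -> F) a :
  (forall t, A t = (h t != 0)) -> \sum_t h t = a -> a != 0 ->
  (forall t, h t != a) -> (2 <= #|A|)%N.
Proof.
move=> AE sh a0 ha; rewrite ltnNge; apply/negP => A1.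
have [t0 At0|A0] := pickP A; last first.
  by move: a0; rewrite -sh big1 ?eqxx // => t _; apply/eqP/negPn; rewrite -AE A0.
move: (ha t0); rewrite -sh (bigD1 t0) //= big1 ?addr0 ?eqxx // => t tt0.
apply/eqP/negPn; rewrite -AE; apply: contra tt0 => At.
by apply/eqP/(card_le1_eqP A1).
Qed.

Lemma hyperplane_sum_subspace :
  exists alpha (U : {vspace 'rV[F]_k.+2}), forall v, f v = alpha * (v \in U)%:R.
Proof.
have q1 : (1 < q)%N := finNzRing_gt1 F.
have X0 : (0 < q ^ k)%N by rewrite expn_gt0; lia.
have [||t e fe|U EU] := @vspace_of_closed F k.+2 (fun e => f e == f 0).
- exact: eqxx.
- by move=> u v /eqP Hu /eqP Hv; rewrite hyperplane_sum_shift // Hu.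
- by have [->|t0] := eqVneq t 0; rewrite ?scale0r ?eqxx ?subspace_sumZ.
exists (f 0), U => v.
have U0 : f 0 != 0 -> forall u, u \in U -> f u != 0.
  by move=> f0 u; rewrite EU => /eqP->.
have := card_vspaceC U; rewrite !expnS; set CU := #|[pred v | v \notin U]| => cU.
have wE : weight f = #|[pred v | (v != 0) && (f v != 0)]| by [].
(* If f(0) = 0, the zeros form the subspace U; were U proper, its complement would exceed the weight
   bound. *)
have [f0|f0] := eqVneq (f 0) 0.
  rewrite f0 mul0r; apply/eqP/negPn/negP => fv.
  have vU : v \notin U by rewrite EU f0.
  have := max_card (mem (U + <[v]>)%VS); rewrite card_add_line // card_rV !expnS => lU.
  have : (CU <= weight f)%N.
    apply: subset_leq_card; apply/subsetP => u; rewrite !inE EU f0 andbC => fu.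
    by rewrite fu /=; apply: contraNneq fu => ->; rewrite f0.
  move: wf cU lU q1 X0; set X := (q ^ k)%N; move: (q) #|U| CU (weight f) => Q u C W.
  move=> H1 H2 H3 H4 H5 H6.
  have : (u <= Q * X)%N by rewrite -(@leq_pmul2l Q) // ltnW.
  have [b bE] : exists b, Q = (b + 2)%N by exists (Q - 2)%N; lia.
  by subst Q; rewrite (_ : b + 2 - 1 = b + 1)%N in H1; lia.
have [z /eqP fz|nz] := pickP [pred z | f z == 0]; last first.
  have : (weight f).+1 = (q ^ k.+2)%N.
    rewrite -card_rV (cardD1 0) /= add1n wE; congr (_.+1); apply: eq_card => u.
    by rewrite !inE; have := nz u; rewrite /= => ->; rewrite !andbT.
  move: wf q1 X0; rewrite !expnS; set X := (q ^ k)%N; move: (q) (weight f) => Q W.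
  move=> H1 H2 H3 H4; have [b bE] : exists b, Q = (b + 2)%N by exists (Q - 2)%N; lia.
  subst Q; rewrite (_ : b + 2 - 1 = b + 1)%N in H1; last by lia.
  by have : (b + 1 <= (b + 1) * X)%N; rewrite ?leq_pmulr //; lia.
have zU : z \notin U by rewrite EU fz eq_sym.
have fzt t u : u \in U -> t != 0 -> f (u + t *: z) = 0.
  move=> uU t0; rewrite addrC hyperplane_sum_shift ?subspace_sumZ //.
  by apply/eqP; rewrite -EU.
pose M := (U + <[z]>)%VS.
(* On M, [f] is f(0) times the indicator of U; it remains to exclude that M is proper. *)
have [/forallP MT|] := boolP [forall u, u \in M].
  have /memv_addP[u uU [w /vlineP[t ->] ->]] := MT v.
  have [->|t0] := eqVneq t 0.
    by rewrite scale0r addr0 uU mulr1; apply/eqP; rewrite -EU.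
  rewrite fzt // (_ : _ \in U = false) ?mulr0 //; apply: contraNF zU => H.
  by rewrite -[z]scale1r -(mulVf t0) -scalerA memvZ // -(addKr u (t *: z)) memvD ?memvN.
case/forallPn => v1 v1M.
have cM : #|M| = (q * #|U|)%N by rewrite card_add_line.
have := max_card (mem (M + <[v1]>)%VS); rewrite card_add_line // cM card_rV !expnS => lU.
have := card_vspaceC M; rewrite cM !expnS; set CM := #|[pred v | v \notin M]| => CME.
(* Count along the direction z. A line inside M meets U, where [f] is nonzero. A line outside M has
   sum f(0) - f(z) = f(0) but never takes the value f(0), so it has at least two nonzero values. *)
have lA : (#|M| + 2 * CM <= q * #|[pred v | (f v != 0)%R]|)%N.
  rewrite -(sum_card_line [pred v | f v != 0] z) (bigID (mem M)) /= leq_add //.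
    rewrite -sum1_card; apply: leq_sum => u /memv_addP[w wU [x /vlineP[t ->] ->]].
    apply/card_gt0P; exists (- t); rewrite inE /=.
    by rewrite scaleNr addrK U0.
  rewrite mulnC -sum_nat_const; apply: leq_sum => u uM.
  apply: (@two_le_card _ (fun t => f (u + t *: z)) (f 0)) => //.
    by rewrite sum_line_hyperplane fz subr0.
  move=> t; rewrite -EU; apply: contra uM => uU.
  by rewrite -(addrK (t *: z) u) -scaleNr memv_add // memvZ // memv_line.
have := card_le_weight f; move: lA; rewrite cM; set A := #|[pred v | (f v != 0)%R]|.
move: wf lU CME q1 X0; set X := (q ^ k)%N; move: (q) #|U| CM (weight f) A => Q u C W A.
move=> H1 H2 H3 H4 H5 H6 H7.
have lu : (u <= X)%N by rewrite -(@leq_pmul2l (Q * Q)) ?muln_gt0 ?(ltnW H4) //; lia.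
have [b bE] : exists b, Q = (b + 2)%N by exists (Q - 2)%N; lia.
subst Q; rewrite (_ : b + 2 - 1 = b + 1)%N in H1; last by lia.
have : (2 * (b + 2) * X <= A + u)%N by rewrite -(@leq_pmul2l (b + 2)) ?(ltnW H4) //; lia.
lia.
Qed.

End Hyperplanes.

(** * Lowering the codimension by summing along lines *)

Lemma card_nonzero : #|[pred t : F | t != 0]| = (q - 1)%N.
Proof.
rewrite subn1 -(cardC1 0); exact: eq_card.
Qed.

(** A bad direction is recovered from t and x = u + t r as (x - u) / t. *)
Lemma card_bad_directions N (f : 'rV[F]_N -> F) (u : 'rV[F]_N) :
  (#|[pred r : 'rV[F]_N | (r != 0%R) && [exists t : F, (t != 0%R) && (f (u + t *: r)%R != 0%R)]]|
   <= (q - 1) * #|[pred x | (x != u) && (f x != 0%R)]|)%N.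
Proof.
rewrite -card_nonzero -cardX.
apply: leq_trans (leq_image_card (fun tx : F * 'rV[F]_N => tx.1^-1 *: (tx.2 - u)) _).
apply: subset_leq_card; apply/subsetP => r; rewrite inE /=.
case/andP => r0 /existsP[t /andP[t0 ft]]; apply/imageP; exists (t, u + t *: r).
  rewrite !inE /= t0 ft andbT /= -subr_eq0 addrC addKr scaler_eq0 negb_or t0.
  exact: r0.
by rewrite /= addrC addKr scalerA mulVf // scale1r.
Qed.

(** A vector with nonzero sum is either a nonzero support vector minus some t r, or a nonzero
    multiple of r whose line meets the support at 0. *)
Lemma weight_sum_line N (f : 'rV[F]_N -> F) r :
  (weight (fun v => (\sum_t f (v + t *: r))%R) <= q * weight f + (q - 1))%N.
Proof.
pose B := [pred v : 'rV[F]_N | (v != 0) && (f v != 0)].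
pose h1 (tv : F * 'rV[F]_N) := tv.2 - tv.1 *: r.
rewrite -card_nonzero /weight -[#|[pred v | _ & f v != 0]|]/#|B| -cardX -cardsE.
apply: leq_trans (leq_add (leq_imset_card h1 _) (leq_imset_card (fun t => t *: r) _)).
apply: leq_trans (leq_card_setU _ _); apply: subset_leq_card.
apply/subsetP => v; rewrite inE => /andP[v0 sv]; rewrite inE.
have [t ft|nf] := pickP [pred t | f (v + t *: r) != 0]; last first.
  by move: sv; rewrite big1 ?eqxx // => t _; apply/eqP/negPn/negbT/nf.
have [vt|vt] := eqVneq (v + t *: r) 0.
  apply/orP; right; apply/imsetP; exists (- t); last first.
    by apply/eqP; rewrite scaleNr -addr_eq0 vt.
  by rewrite inE oppr_eq0; apply: contraNneq v0 => t0; rewrite -vt t0 scale0r addr0.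
apply/orP; left; apply/imsetP; exists (t, v + t *: r); last by rewrite /h1 addrK.
by rewrite !inE /= vt.
Qed.

Lemma exists_good_direction N k (f : 'rV[F]_N -> F) s1 s2 :
  (k.+3 <= N)%N -> (weight f + (q - 1) <= 2 * q ^ k * (q - 1))%N ->
  s1 != 0 -> f s1 != 0 -> s2 != 0 -> f s2 != 0 ->
  exists2 r, r != 0 & forall u, u \in [:: s1; s2; s1 + s2] ->
    forall t, t != 0 -> f (u + t *: r) = 0.
Proof.
move=> kN wf s10 fs1 s20 fs2.
pose bad u := [set r : 'rV[F]_N | (r != 0) && [exists t : F, (t != 0) && (f (u + t *: r) != 0)]].
have bnd u : (#|bad u| <= (q - 1) * (weight f).+1)%N.
  rewrite cardsE; apply: leq_trans (card_bad_directions f u) _; rewrite leq_mul2l.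
  apply/orP; right; apply: leq_trans (card_le_weight f); apply: subset_leq_card.
  by apply/subsetP => x; rewrite !inE => /andP[].
(* The vector u is itself in the support but not among the x that are counted, which saves one. *)
have bnd' u : u != 0 -> f u != 0 -> (#|bad u| <= (q - 1) * weight f)%N.
  move=> u0 fu; rewrite cardsE; apply: leq_trans (card_bad_directions f u) _.
  rewrite leq_mul2l; apply/orP; right; rewrite -ltnS; apply: leq_trans (card_le_weight f).
  rewrite [X in (_ < X)%N](cardD1 u) inE /= fu ltnS.
  by apply: subset_leq_card; apply/subsetP => x; rewrite !inE.
pose allbad := [set 0] :|: (bad s1 :|: bad s2 :|: bad (s1 + s2)).
(* The bound is at most 6 (q - 1)^2 q^k, and q^3 - 6 (q - 1)^2 = (q - 2)^3 + 2 is positive. *)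
have : (#|allbad| < q ^ N)%N.
  apply: (@leq_ltn_trans (1 + (((q - 1) * weight f + (q - 1) * weight f)
                           + (q - 1) * (weight f).+1))%N).
    apply: leq_trans (leq_card_setU _ _) _; rewrite cards1 leq_add2l.
    apply: leq_trans (leq_card_setU _ _) _; rewrite leq_add ?bnd //.
    by apply: leq_trans (leq_card_setU _ _) _; rewrite leq_add ?bnd'.
  have q1 : (1 < q)%N := finNzRing_gt1 F.
  have : (q ^ k.+3 <= q ^ N)%N by rewrite leq_exp2l.
  have X0 : (0 < q ^ k)%N by rewrite expn_gt0; lia.
  move: wf q1 X0; rewrite !expnS; set X := (q ^ k)%N; move: (q) (weight f) (_ ^ N)%N.
  move=> Q W Y H1 H2 H3 H4; have [b bE] : exists b, Q = (b + 2)%N by exists (Q - 2)%N; lia.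
  subst Q; rewrite (_ : b + 2 - 1 = b + 1)%N in H1 *; last by lia.
  have H5 : ((b + 1) * (W + (b + 1)) <= (b + 1) * (2 * X * (b + 1)))%N by rewrite leq_mul2l H1 orbT.
  apply: leq_trans H4; have : (3 * b * b * X <= b * b * b * X + 3 * b * X)%N.
    case: (b) => [|[|[|b']]] //=; first by lia.
      by lia.
    lia.
  lia.
rewrite -(card_rV F N) -subn_gt0 => lt.
have /set0Pn[r] : ~: allbad != set0 by rewrite -card_gt0 cardsCs setCK.
rewrite in_setC !in_setU in_set1 !negb_or => /andP[r0 /andP[/andP[b1 b2] b3]].
exists r => // u uE t t0; apply/eqP/negPn/negP => fu.
suff bu : r \in bad u.
  by move: uE b1 b2 b3 bu; rewrite !inE => /or3P[] /eqP-> => [/negPf->|_ /negPf->|_ _ /negPf->].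
by rewrite inE r0; apply/existsP; exists t; rewrite t0.
Qed.

(** Induction on the codimension. For s1 and s2 in the support, a good direction r makes the line
    sum agree with [f] at s1, s2 and s1 + s2; the line sum has smaller codimension, so by induction
    [f] is equal at these three vectors. *)
Theorem small_subspace_sum c k N (s : seq (F * 'M[F]_(N, c.+1))) :
  N = (k + c).+2 ->
  (weight (subspace_sum s) + (q - 1) <= 2 * q ^ k * (q - 1))%N ->
  exists alpha (U : {vspace 'rV[F]_N}),
    forall v, subspace_sum s v = alpha * (v \in U)%:R.
Proof.
elim: c k s => [|c IH] k s NE wf.
  by rewrite addn0 in NE; subst N; apply: hyperplane_sum_subspace wf.
set f := subspace_sum s in wf *.
have q1 : (1 < q)%N := finNzRing_gt1 F.
have key s1 s2 : s1 != 0 -> f s1 != 0 -> s2 != 0 -> f s2 != 0 ->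
    f s1 = f s2 /\ f (s1 + s2) = f s1.
  move=> s10 fs1 s20 fs2.
  have kN : (k.+3 <= N)%N by rewrite NE; lia.
  have [r r0 good] := exists_good_direction kN wf s10 fs1 s20 fs2.
  have [s' s'E] := sum_line_subspace s r.
  have fr u : u \in [:: s1; s2; s1 + s2] -> f u = subspace_sum s' u.
    move=> uE; rewrite -s'E (bigD1 0) //= scale0r addr0 big1 ?addr0 // => t t0.
    exact: good.
  (* The weight grows to at most q times itself plus q - 1; the slack q - 1 in the hypothesis
     absorbs this and yields the bound for k + 1. *)
  have [|//|a [U UE]] := IH k.+1 s'; first by rewrite NE; lia.
    have := weight_sum_line f r.
    have -> : weight (fun v => \sum_t f (v + t *: r)) = weight (subspace_sum s').
      by apply: eq_card => v; rewrite !inE s'E.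
    have X0 : (0 < q ^ k)%N by rewrite expn_gt0; lia.
    move: wf q1 X0; rewrite expnS; set X := (q ^ k)%N.
    move: (q) (weight (subspace_sum s')) (weight _) => Q W' W H1 H2 H3 H4.
    have [b bE] : exists b, Q = (b + 2)%N by exists (Q - 2)%N; lia.
    subst Q; rewrite (_ : b + 2 - 1 = b + 1)%N in H1 H4 *; last by lia.
    have : ((b + 2) * (W + (b + 1)) <= (b + 2) * (2 * X * (b + 1)))%N by rewrite leq_mul2l H1 orbT.
    lia.
  have E1 := fr s1 (mem_head _ _).
  have E2 : f s2 = _ := fr s2 _; have E3 : f (s1 + s2) = _ := fr (s1 + s2) _.
  move: fs1 fs2; rewrite E1 E2 ?E3 ?inE ?eqxx ?orbT // !UE.
  have [s1U|] := boolP (s1 \in U); last by rewrite mulr0 eqxx.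
  have [s2U|] := boolP (s2 \in U); last by rewrite mulr0 eqxx.
  by rewrite memvD.
have fZ t v : t != 0 -> f (t *: v) = f v by apply: subspace_sumZ.
have [s0 /andP[s00 fs0]|nz] := pickP [pred v | (v != 0) && (f v != 0)]; last first.
  exists (f 0), 0%VS => v; rewrite memv0; have [->|v0] := eqVneq; first by rewrite mulr1.
  by rewrite mulr0; apply/eqP; have := nz v; rewrite /= v0 => /negbFE.
(* Zero is the sum of the support vectors s0 and -s0. *)
have f0 : f 0 = f s0.
  have [||||_ ] := key s0 (-1 *: s0); rewrite ?fZ ?scaler_eq0 ?oppr_eq0 ?oner_eq0 //.
  by rewrite scaleN1r subrr.
have [|u v|t v|U UE] := @vspace_of_closed F N (fun v => f v != 0).
- by rewrite f0.
- have [->|u0] := eqVneq u 0; first by rewrite add0r.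
  have [->|v0] := eqVneq v 0; first by rewrite addr0.
  by move=> fu fv; have [_ ->] := key u v u0 fu v0 fv.
- by have [->|t0] := eqVneq t 0; rewrite ?scale0r ?f0 // fZ.
exists (f s0), U => v; rewrite UE.
have [fv|fv] := eqVneq (f v) 0; first by rewrite fv mulr0.
rewrite mulr1; have [->|v0] := eqVneq v 0; first by rewrite f0.
by have [] := key v s0 v0 fv s00 fs0.
Qed.

End SmallSubspaceSums.

(** * Counting the j-spaces of a set through a subspace *)

Section Gauss.

Variable q : nat.
Hypothesis q_gt1 : (1 < q)%N.

Lemma expq_gt1 m : (0 < m)%N -> 0 < q%:R ^+ m - 1 :> rat.
Proof. by move=> m0; rewrite subr_gt0 exprn_egt1 ?ltr1n // -lt0n. Qed.

Lemma gauss_n0 a : gauss q a 0 = 1.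
Proof. by rewrite /gauss !big_ord0 divr1. Qed.

Lemma gaussSS a b :
  gauss q a.+1 b.+1 * (q%:R ^+ b.+1 - 1) = (q%:R ^+ a.+1 - 1) * gauss q a b.
Proof.
rewrite /gauss !big_ord_recl /= !subn0.
under eq_bigr => i _ do rewrite /bump leq0n add1n subSS.
under [X in _ / (_ * X)]eq_bigr => i _ do rewrite /bump leq0n add1n subSS.
have b0 : \prod_(i < b) (q%:R ^+ (b - i) - 1) != 0 :> rat.
  by apply/prodf_neq0 => i _; rewrite gt_eqF // expq_gt1 // subn_gt0.
by have := expq_gt1 (ltn0Sn b); move/lt0r_neq0 => H; field; rewrite b0 H.
Qed.

Lemma gauss_gt0 a b : (b <= a)%N -> 0 < gauss q a b.
Proof.
elim: b a => [|b IH] [|a] // ab; rewrite ?gauss_n0 //.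
rewrite -(@pmulr_lgt0 _ (q%:R ^+ b.+1 - 1)) ?expq_gt1 // gaussSS.
by rewrite mulr_gt0 ?expq_gt1 ?IH.
Qed.

(** With m the dimension of M, b = j - m and a = k - m, the factors become q^(j+1) - q^m and q^(k+1)
    - q^m, as they occur when counting vectors outside M. *)
Lemma gauss_step a b m :
  gauss q a.+1 b.+1 * (q%:R ^+ (b.+1 + m) - q%:R ^+ m) =
  (q%:R ^+ (a.+1 + m) - q%:R ^+ m) * gauss q a b.
Proof.
rewrite !exprD; move: (gaussSS a b) (q%:R ^+ m) => E z.
rewrite -[X in _ * (_ - X)]mul1r -[X in (_ - X) * _]mul1r -!mulrBl mulrA E.
by rewrite mulrAC.
Qed.

Lemma weight_boundE j k :
  weight_bound q j k * (q%:R ^+ j.+1 - 1) = 2 * q%:R ^+ k * (q%:R - 1) * gauss q k j.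
Proof.
rewrite /weight_bound /theta; have := gaussSS j 0; rewrite gauss_n0 expr1 mulr1.
have := expq_gt1 (ltn0Sn 0); have := expq_gt1 (ltn0Sn j); rewrite expr1.
set x := q%:R ^+ j.+1 - 1; set y := q%:R - 1 => x0 y0 <-.
have g0 := gauss_gt0 (ltn0Sn j : 1 <= j.+1)%N.
by field; rewrite gt_eqF.
Qed.

End Gauss.

(** * Double counting of spaces and vectors *)

Section Counting.

Variables (F : finFieldType) (N j k : nat).
Local Notation V := 'rV[F]_N.
Local Notation q := #|F|.

Lemma intermediate_vspace (M W : {vspace V}) d :
  (M <= W)%VS -> (\dim M <= d <= \dim W)%N ->
  exists M' : {vspace V}, [/\ (M <= M')%VS, (M' <= W)%VS & \dim M' = d].
Proof.
move=> MW; elim: d => [|d IH] /andP[Md dW].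
  by exists M; split=> //; apply/eqP; rewrite -leqn0.
move: Md; rewrite leq_eqVlt => /predU1P[<-|Md]; first by exists M.
have [|M' [MM' M'W dM']] := IH; first by rewrite -ltnS Md ltnW.
have /subvPn[v vW vM'] : ~~ (W <= M')%VS.
  by apply: contraL dW => /dimvS; rewrite dM' -leqNgt.
exists (M' + <[v]>)%VS; split; last by rewrite dim_add_line // dM'.
  by apply: subv_trans MM' (addvSl _ _).
by rewrite subv_add M'W -memvE vW.
Qed.

Lemma add_line_eq (M W : {vspace V}) v : (M <= W)%VS -> v \in W -> v \notin M ->
  \dim W = (\dim M).+1 -> (M + <[v]>)%VS = W.
Proof.
move=> MW vW vM dW; have MvW : (M + <[v]> <= W)%VS by rewrite subv_add MW -memvE vW.
by apply/eqP; rewrite eqEdim MvW dim_add_line ?dW ?leqnn.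
Qed.

Lemma exists_notin (M W : {vspace V}) : (\dim M < \dim W)%N ->
  exists2 v, v \in W & v \notin M.
Proof. by move=> dMW; apply/subvPn; apply: contraL dMW => /dimvS; rewrite -leqNgt. Qed.

Variable S : pred {vspace V}.
Hypothesis dimS : forall W, S W -> \dim W = j.+1.

Definition through (M : {vspace V}) : nat := #|[pred W | S W && (M <= W)%VS]|.
(** This is the size of the union of the spaces of [S] that contain [M]. *)
Definition reach (M : {vspace V}) : nat :=
  #|[pred v : V | (0 < through (M + <[v]>))%N]|.

Lemma throughP M : reflect (exists2 W, S W & (M <= W)%VS) (0 < through M)%N.
Proof.
by apply: (iffP card_gt0P) => [[W /andP[]]|[W SW MW]]; exists W => //; apply/andP.
Qed.

Lemma throughS M M' : (M <= M')%VS -> (through M' <= through M)%N.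
Proof.
move=> MM'; apply: subset_leq_card; apply/subsetP => W.
by rewrite !inE => /andP[-> /(subv_trans MM')].
Qed.

Lemma reachS M M' : (M <= M')%VS -> (reach M' <= reach M)%N.
Proof.
move=> MM'; apply: subset_leq_card; apply/subsetP => v; rewrite !inE => /leq_trans.
by apply; apply: throughS; apply: addvS.
Qed.

(** Double counting of the pairs (W, v) with W in [S] through M and v in W outside M. *)
Lemma sum_through M : (\dim M <= j)%N ->
  (through M * (q ^ j.+1 - q ^ \dim M) =
   \sum_(v : V | v \notin M) through (M + <[v]>)%VS)%N.
Proof.
move=> dM; rewrite /through.
under [RHS]eq_bigr => v _ do rewrite -sum1_card big_mkcond /=.
rewrite exchange_big -sum_nat_const big_mkcond /=; apply: eq_bigr => W _.
rewrite !inE; case: ifP => [/andP[SW MW]|SMW]; last first.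
  by rewrite big1 // => v _; rewrite !inE subv_add andbA SMW.
rewrite -(dimS SW) -!card_rV_vspace -(cardID (mem M) (mem W)).
rewrite (_ : #|[predI W & M]| = #|M|); last first.
  by apply: eq_card => v; rewrite !inE andb_idl // => /(subvP MW).
rewrite addKn -sum1_card big_mkcond [RHS]big_mkcond /=; apply: eq_bigr => v _.
by rewrite !inE subv_add SW MW -memvE /=; case: (v \in M).
Qed.

Lemma reach_through_gt0 M : (0 < through M)%N ->
  (reach M = #|[pred v : V | (v \notin M) && (0 < through (M + <[v]>))%N]| + q ^ \dim M)%N.
Proof.
move=> tM.
have <- : (#|[predI [pred v : V | 0 < through (M + <[v]>)] & M]| = q ^ \dim M)%N.
  rewrite -card_rV_vspace; apply: eq_card => v; rewrite !inE andb_idl // => vM.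
  by rewrite (addv_idPl _) // -memvE.
rewrite /reach -(cardID (mem M) [pred v : V | 0 < through (M + <[v]>)]%N).
by rewrite [LHS]addnC; congr (_ + _)%N; apply: eq_card => v; rewrite !inE.
Qed.

Lemma le_through M (g : rat) : (\dim M <= j)%N -> (0 < through M)%N ->
  (forall v, v \notin M -> (0 < through (M + <[v]>))%N -> g <= (through (M + <[v]>))%:R) ->
  ((reach M)%:R - q%:R ^+ \dim M) * g <=
    (through M)%:R * (q%:R ^+ j.+1 - q%:R ^+ \dim M).
Proof.
move=> dM tM Hg; rewrite reach_through_gt0 // natrD natrX addrK.
have le : (q ^ \dim M <= q ^ j.+1)%N by rewrite leq_exp2l ?finNzRing_gt1 // leqW.
rewrite -!natrX -natrB // -natrM sum_through // natr_sum -sum1_card natr_sum mulr_suml.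
rewrite [leRHS](bigID (fun v => 0 < through (M + <[v]>))%N) /= ler_wpDr //.
  by rewrite sumr_ge0.
rewrite big_mkcond [leRHS]big_mkcond; apply: ler_sum => v _ /=.
rewrite !inE; case: (v \in M) (Hg v) => //=; case: (0 < _)%N => //= H.
by rewrite mul1r H.
Qed.

Lemma lt_through M v0 (g : rat) : (\dim M <= j)%N -> (0 < through M)%N ->
  (forall v, v \notin M -> (0 < through (M + <[v]>))%N -> g <= (through (M + <[v]>))%:R) ->
  v0 \notin M -> (0 < through (M + <[v0]>))%N -> g < (through (M + <[v0]>))%:R ->
  ((reach M)%:R - q%:R ^+ \dim M) * g <
    (through M)%:R * (q%:R ^+ j.+1 - q%:R ^+ \dim M).
Proof.
move=> dM tM Hg v0M tv0 gv0; rewrite reach_through_gt0 // natrD natrX addrK.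
have le : (q ^ \dim M <= q ^ j.+1)%N by rewrite leq_exp2l ?finNzRing_gt1 // leqW.
rewrite -!natrX -natrB // -natrM sum_through // natr_sum -sum1_card natr_sum mulr_suml.
rewrite [ltRHS](bigID (fun v => 0 < through (M + <[v]>))%N) /= ltr_wpDr //.
  by rewrite sumr_ge0.
rewrite (bigD1 v0) ?inE ?v0M //= [ltRHS](bigD1 v0) ?v0M //= mul1r ltr_leD //.
rewrite big_mkcond [leRHS]big_mkcond; apply: ler_sum => v _ /=.
rewrite !inE; case: (v \in M) (Hg v) => //=; case: (0 < _)%N => //= H.
by case: (v != v0); rewrite ?mul1r ?H.
Qed.

Hypothesis j_lt_k : (j < k)%N.

Hypothesis reach_ge : forall M : {vspace V},
  \dim M = j -> (0 < through M)%N -> (q ^ k.+1 <= reach M)%N.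

Lemma reach_ge_all (M : {vspace V}) : (\dim M <= j)%N -> (0 < through M)%N ->
  (q ^ k.+1 <= reach M)%N.
Proof.
move=> dM /throughP[W SW MW].
have [|M' [MM' M'W dM']] := @intermediate_vspace M W j MW.
  by rewrite dM (dimS SW) leqnSn.
apply: leq_trans (reachS MM'); apply: reach_ge => //.
by apply/throughP; exists W.
Qed.

(** Descending induction on the dimension of M, from M in [S], where the coefficient is 1. In the
    step, [le_through] averages the bounds for M + <v> over at least q^(k+1) - q^(dim M) vectors
    v. *)
Lemma gauss_le_through (M : {vspace V}) : (\dim M <= j.+1)%N -> (0 < through M)%N ->
  gauss q (k.+1 - \dim M) (j.+1 - \dim M) <= (through M)%:R.
Proof.
have [d] := ubnP (j.+1 - \dim M); elim: d => // d IH in M * => dM.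
rewrite leq_eqVlt => /predU1P[->|]; first by rewrite subnn gauss_n0 ler1n.
rewrite ltnS => Mj tM.
have q1 : (1 < q)%N := finNzRing_gt1 F.
have pos : (0 : rat) < q%:R ^+ j.+1 - q%:R ^+ \dim M.
  by rewrite subr_gt0 ltr_eXn2l ?ltr1n // ltnS.
rewrite -(ler_pM2r pos);
apply: le_trans (le_through Mj tM (g := gauss q (k - \dim M) (j - \dim M)) _).
  rewrite !subSn //; last by lia.
  have := gauss_step q1 (k - \dim M) (j - \dim M) (\dim M).
  rewrite !addSn !subnK //; last by lia.
  move=> ->; rewrite ler_wpM2r //.
    by rewrite ltW // gauss_gt0 //; lia.
  by rewrite lerB // -natrX ler_nat reach_ge_all.
move=> v vM tv; have := IH (M + <[v]>)%VS; rewrite dim_add_line // !subSS.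
by apply => //; lia.
Qed.

End Counting.

(** * Codewords *)

Section PrimeSubfield.

Variables (p : nat) (F : finFieldType).
Hypothesis p_char : p \in [pchar F].

(** Coefficients are only added and multiplied by 0 or 1, so an additive injection on
    representatives is enough. *)
Definition Fp_embed (x : 'F_p) : F := (x : nat)%:R.

Lemma Fp_embedD x y : Fp_embed (x + y) = Fp_embed x + Fp_embed y.
Proof.
rewrite /Fp_embed -natrD -[RHS](GRing.natr_mod_pchar p_char) /=.
by congr (_ %% _)%N%:R; apply: (Fp_cast (pcharf_prime p_char)).
Qed.

Lemma Fp_embed0 : Fp_embed 0 = 0. Proof. by []. Qed.

Lemma Fp_embed_eq0 x : (Fp_embed x == 0) = (x == 0).
Proof.
have pp := pcharf_prime p_char.
rewrite /Fp_embed -(dvdn_pcharf p_char) -val_eqE /=; case: (posnP x) => [->|x0].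
  by rewrite dvdn0.
rewrite gtnNdvd //.
by rewrite -[X in (_ < X)%N](Fp_cast pp) ltn_ord.
Qed.

Lemma Fp_embed_inj : injective Fp_embed.
Proof.
move=> x y E; apply/eqP; rewrite -subr_eq0 -Fp_embed_eq0; apply/eqP.
by apply: (addIr (Fp_embed y)); rewrite -Fp_embedD subrK add0r.
Qed.

Lemma Fp_embed_sum (I : finType) (f : I -> 'F_p) :
  Fp_embed (\sum_i f i) = \sum_i Fp_embed (f i).
Proof. exact: (big_morph _ Fp_embedD Fp_embed0). Qed.

End PrimeSubfield.

(** * Subspaces as matrix kernels, and weights as multiples of q - 1 *)

Section Spaces.

Variables (F : finFieldType) (N : nat).
Local Notation V := 'rV[F]_N.
Local Notation q := #|F|.

Lemma dim_rV : \dim {: V} = N.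
Proof.
apply/eqP; rewrite -(eqn_exp2l _ _ (finNzRing_gt1 F)) -card_rV_vspace -card_rV.
by apply/eqP/eq_card => v; rewrite memvf.
Qed.

Lemma vspace_kernel (U : {vspace V}) c : (\dim U + c = N)%N ->
  exists A : 'M[F]_(N, c), forall v, (v *m A == 0) = (v \in U).
Proof.
move=> dU; pose B := \matrix_(i < \dim U) (vbasis U)`_i.
have mulB (u : 'rV_(\dim U)) : u *m B = \sum_i u 0 i *: (vbasis U)`_i.
  by rewrite mulmx_sum_row; apply: eq_bigr => i _; rewrite rowK.
have rB : \rank B = \dim U.
  apply/eqP/inj_row_free => u; rewrite mulB => u0.
  have /freeP/(_ (fun i => u 0 i) u0) := basis_free (vbasisP U).
  by move=> H; apply/rowP => i; rewrite H mxE.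
have [A EA] := @kernel_matrix F _ _ c B (etrans (congr1 (addn^~ c) rB) dU).
exists A => v; rewrite EA; apply/submxP/idP => [[u ->]|vU].
  rewrite mulB; apply: memv_suml => i _; apply/memvZ/vbasis_mem/mem_nth.
  by rewrite size_tuple.
exists (\row_i coord (vbasis U) i v); rewrite mulB [LHS](coord_vbasis vU).
by apply: eq_bigr => i _; rewrite mxE.
Qed.

(** The nonzero support is a disjoint union of lines without 0. *)
Lemma weight_dvd (f : V -> F) : (forall t v, t != 0 -> f (t *: v) = f v) ->
  (q - 1 %| weight f)%N.
Proof.
move=> fZ; rewrite /weight -[X in (_ %| X)%N]sum1_card.
rewrite (partition_big (fun v : V => <[v]>%VS) xpredT) //=.
apply: dvdn_sum => L _.
have [v0 /andP[/andP[v00 fv0] /eqP LE]|none] :=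
    pickP [pred v : V | (v != 0) && (f v != 0) && (<[v]>%VS == L)]; last first.
  by rewrite big1 // => v; have := none v; rewrite /= !inE => ->.
rewrite (_ : \sum_(_ | _) 1 = q - 1)%N // sum1_card.
have <- : #|[predD1 <[v0]>%VS & 0]| = (q - 1)%N.
  have := cardD1 0 (mem <[v0]>%VS); rewrite card_rV_vspace dim_vline v00 expn1.
  by rewrite mem0v => ->; rewrite add1n subn1.
apply: eq_card => v; rewrite unfold_in /= !inE -LE; case: (eqVneq v 0) => //= v_0.
apply/andP/idP => [[_ /eqP<-]|/vlineP[t vE]]; first exact: memv_line.
have t0 : t != 0 by apply: contraNneq v_0 => t0; rewrite vE t0 scale0r.
rewrite vE fZ // fv0 eqEdim -memvE memvZ ?memv_line //.
by rewrite !dim_vline v00 scaler_eq0 negb_or t0 v00.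
Qed.

End Spaces.

Lemma mul_le_gap Q X : (1 < Q)%N -> (0 < X)%N -> (Q * X <= 2 * X * (Q - 1))%N.
Proof.
move=> Q1 X0; have [b ->] : exists b, Q = (b + 2)%N by exists (Q - 2)%N; lia.
by rewrite (_ : b + 2 - 1 = b + 1)%N; lia.
Qed.

(** For Q = q and X = q^k, C and D are the sizes of the union and the intersection of two distinct
    (k + 1)-dimensional subspaces. *)
Lemma union_too_big Q X C D : (1 < Q)%N -> (1 < X)%N -> (D <= X)%N ->
  (C + D = Q * X + Q * X)%N -> (C <= (2 * X * (Q - 1)).+1)%N -> False.
Proof.
move=> Q1; have [b ->] : exists b, Q = (b + 2)%N by exists (Q - 2)%N; lia.
by rewrite (_ : b + 2 - 1 = b + 1)%N; lia.
Qed.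

(** * Codewords of small weight *)

Section Codes.

Variables (p : nat) (F : finFieldType) (n j k : nat).
Hypothesis p_char : p \in [pchar F].
Hypotheses (j_lt_k : (j < k)%N) (k_lt_n : (k < n)%N).
Local Notation V := 'rV[F]_n.+1.
Local Notation q := #|F|.
Local Notation emb := (@Fp_embed p F).

Lemma code_sum (c : words p F n j) : c \in code p F n j k ->
  exists a : pgspace F n k -> 'F_p,
    forall lam, c lam = \sum_kap a kap * (val lam <= val kap)%VS%:R.
Proof.
rewrite /code span_def big_image /= => /memv_sumP[vs vsP cE].
have /fin_all_exists[a aE] kap : exists b : 'F_p, vs kap = b *: space_word p j kap.
  by apply/vlineP/vsP.
exists a => lam; rewrite cE sum_ffunE; apply: eq_bigr => kap _.
by rewrite aE !ffunE.
Qed.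

(** Extension by 0 to all subspaces, so that c can be evaluated at M + <v> without carrying a proof
    of its dimension. *)
Definition val_on (c : words p F n j) (W : {vspace V}) : 'F_p :=
  if insub W is Some lam then c lam else 0.

Lemma val_on_val c lam : val_on c (val lam) = c lam.
Proof. by rewrite /val_on valK. Qed.

Lemma val_on_dim c W : val_on c W != 0 -> \dim W = j.+1.
Proof. by rewrite /val_on; case: insubP => [lam /eqP|]; rewrite ?eqxx. Qed.

Lemma wt_through c : wt c = through [pred W | val_on c W != 0] 0%VS.
Proof.
rewrite /wt /through cardsE -(card_image val_inj); apply: eq_card => W.
rewrite !inE sub0v andbT; apply/imageP/idP => [[lam cl ->]|vW].
  by rewrite val_on_val.
have dW : \dim W == j.+1 by rewrite (val_on_dim vW).
by exists (Sub W dW); rewrite ?SubK // unfold_in -val_on_val SubK.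
Qed.

Variables (c : words p F n j) (a : pgspace F n k -> 'F_p).
Hypothesis cE : forall lam, c lam = \sum_kap a kap * (val lam <= val kap)%VS%:R.

(* The terms with kap containing M are kept even for v in M, where the value of
   c at M + <v> would be meaningless: this makes link M a sum of subspaces. *)
Definition link (M : {vspace V}) (v : V) : F :=
  \sum_kap emb (a kap) * ((M <= val kap)%VS && (v \in val kap))%:R.

Lemma emb_val_on W : \dim W = j.+1 ->
  emb (val_on c W) = \sum_kap emb (a kap) * (W <= val kap)%VS%:R.
Proof.
move=> /eqP dW; rewrite -[W](SubK (pgspace F n j) dW) val_on_val cE.
rewrite Fp_embed_sum //; apply: eq_bigr => kap _.
by case: (_ <= _)%VS; rewrite ?mulr1 ?mulr0.
Qed.

Lemma link_notin (M : {vspace V}) v : \dim M = j -> v \notin M ->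
  link M v = emb (val_on c (M + <[v]>)%VS).
Proof.
move=> dM vM; rewrite emb_val_on ?dim_add_line ?dM //.
by apply: eq_bigr => kap _; rewrite subv_add -memvE.
Qed.

Lemma link_in (M : {vspace V}) v : v \in M -> link M v = link M 0.
Proof.
move=> vM; apply: eq_bigr => kap _; rewrite mem0v.
by have [Mk|//] := boolP (M <= val kap)%VS; rewrite (subvP Mk).
Qed.

Lemma linkZ M t v : t != 0 -> link M (t *: v) = link M v.
Proof. by move=> t0; apply: eq_bigr => kap _; rewrite rpredZeq (negPf t0). Qed.

Lemma link_subspace_sum M :
  exists s : seq (F * 'M[F]_(n.+1, (n - k.+1).+1)), link M =1 subspace_sum s.
Proof.
have /fin_all_exists[A AE] (kap : pgspace F n k) :
    exists A : 'M[F]_(n.+1, (n - k.+1).+1), forall v, (v *m A == 0) = (v \in val kap).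
  by apply: vspace_kernel; rewrite (eqP (valP kap)); lia.
exists [seq (emb (a kap) * (M <= val kap)%VS%:R, A kap) | kap <- index_enum (pgspace F n k)].
move=> v; rewrite /subspace_sum big_map; apply: eq_bigr => kap _.
by rewrite AE -mulrA -natrM mulnb.
Qed.

Lemma card_eq0_vspace (U : {vspace V}) : (0 < \dim U)%N -> #|U|%:R = 0 :> F.
Proof.
by move=> dU; rewrite card_rV_vspace natrX card_eq0 expr0n gtn_eqF.
Qed.

Lemma sum_mem_vspace (X U : {vspace V}) :
  \sum_(v in X) (v \in U)%:R = #|(X :&: U)%VS|%:R :> F.
Proof.
rewrite -natr_sum -sum1_card big_mkcond [in RHS]big_mkcond; congr _%:R.
by apply: eq_bigr => v _; rewrite memv_cap; case: (v \in X); case: (v \in U).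
Qed.

(** If dim U <= k, a complement of U meets every k-space in a nonzero subspace, whose size is 0 in
    F, so [link M] sums to 0 over the complement. But the complement meets U only in 0, so that sum
    is alpha. *)
Lemma link_dim M alpha (U : {vspace V}) :
  (forall v, link M v = alpha * (v \in U)%:R) -> alpha != 0 -> (k < \dim U)%N.
Proof.
move=> lE a0; rewrite ltnNge; apply: contraNN a0 => dU; apply/eqP.
have : \sum_(v in (U^C)%VS) link M v = 0.
  rewrite exchange_big big1 //= => kap _; rewrite -big_distrr /=.
  case: (M <= val kap)%VS => /=; last by rewrite big1 ?mulr0.
  set K : {vspace V} := sval kap; have dK : \dim K = k.+1 := eqP (valP kap).
  rewrite sum_mem_vspace card_eq0_vspace ?mulr0 //.
  have := dimv_sum_cap (U^C)%VS K; have := dimvS (subvf (U^C + K)%VS).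
  by rewrite dimv_compl dim_rV dK; lia.
under eq_bigr => v _ do rewrite lE.
rewrite -big_distrr /= sum_mem_vspace capvC capv_compl.
by rewrite card_rV_vspace dimv0 expn0 mulr1.
Qed.

(** Divisibility of the weight by q - 1 turns the strict bound into the one with slack q - 1. The
    dimension is at least k + 1 by [link_dim], and k + 2 would make the weight too large. *)
Lemma link_small M : (weight (link M) < 2 * q ^ k * (q - 1))%N ->
  (exists v, link M v != 0) ->
  exists alpha (U : {vspace V}), [/\ alpha != 0, \dim U = k.+1 &
    forall v, link M v = alpha * (v \in U)%:R].
Proof.
move=> lt [v0 v0l].
have q1 : (1 < q)%N := finNzRing_gt1 F.
have [s sE] := link_subspace_sum M.
have wE : weight (link M) = weight (subspace_sum s).
  by apply: eq_card => v; rewrite !inE sE.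
have /dvdnP[w wEw] := weight_dvd (fun t v t0 => linkZ M v t0).
have [||alpha [U lE]] := @small_subspace_sum F (n - k.+1) k n.+1 s; first by lia.
  rewrite -wE wEw -mulSnr leq_mul2r; apply/orP; right.
  by move: lt; rewrite wEw ltn_pmul2r //; lia.
have {}lE v : link M v = alpha * (v \in U)%:R by rewrite sE lE.
have a0 : alpha != 0 by apply: contraNneq v0l => a0; rewrite lE a0 mul0r.
exists alpha, U; split=> //; apply/eqP; rewrite eqn_leq (link_dim lE) // andbT.
rewrite leqNgt; apply: contraTN lt => dU; rewrite -leqNgt.
have : (q ^ k.+2 <= (weight (link M)).+1)%N.
  apply: (@leq_trans #|U|); first by rewrite card_rV_vspace leq_exp2l.
  apply: leq_trans (card_le_weight (link M)).
  apply: subset_leq_card; apply/subsetP => v vU.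
  by rewrite inE /= lE vU mulr1.
have : (0 < q ^ k)%N by rewrite expn_gt0; lia.
rewrite !expnS; move: q1; set X := (q ^ k)%N; move: (q) (weight _) => Q W.
move=> H1 H2 H3; have [b bE] : exists b, Q = (b + 2)%N by exists (Q - 2)%N; lia.
by subst Q; rewrite (_ : b + 2 - 1 = b + 1)%N; lia.
Qed.

Local Notation S := [pred W | val_on c W != 0].

Lemma link_neq0 M W : \dim M = j -> S W -> (M <= W)%VS ->
  exists2 v, v \notin M & W = (M + <[v]>)%VS.
Proof.
move=> dM SW MW; have dW := val_on_dim SW.
have [|v vW vM] := @exists_notin F _ M W; first by rewrite dM dW.
by exists v => //; rewrite (add_line_eq MW vW) // dM dW.
Qed.

Lemma link_through M v : \dim M = j -> (0 < through S M)%N -> link M v != 0 ->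
  (0 < through S (M + <[v]>))%N.
Proof.
move=> dM tM lv; have [vM|vM] := boolP (v \in M); first by rewrite (addv_idPl _) // -memvE.
apply/throughP; exists (M + <[v]>)%VS; rewrite ?subvv // inE /=.
by rewrite -(Fp_embed_eq0 p_char) -link_notin.
Qed.

Lemma weight_lt_reach M : \dim M = j -> (0 < through S M)%N ->
  (weight (link M) < reach S M)%N.
Proof.
move=> dM tM; rewrite /reach (cardD1 0) inE addv0 tM ltnS.
apply: subset_leq_card; apply/subsetP => v; rewrite !inE => /andP[-> lv] /=.
exact: link_through.
Qed.

Lemma link_support M : \dim M = j -> (0 < through S M)%N ->
  exists v, link M v != 0.
Proof.
move=> dM /throughP[W SW MW]; have [v vM WE] := link_neq0 dM SW MW.
by exists v; rewrite link_notin // -WE (Fp_embed_eq0 p_char).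
Qed.

(** Either the weight is small and the support of [link M] is a (k + 1)-dimensional subspace, or the
    weight is at least 2 q^k (q - 1) >= q^(k+1). *)
Lemma reach_codeword M : \dim M = j -> (0 < through S M)%N ->
  (q ^ k.+1 <= reach S M)%N.
Proof.
move=> dM tM; apply: leq_trans (weight_lt_reach dM tM).
have q1 : (1 < q)%N := finNzRing_gt1 F.
have [lt|ge] := ltnP (weight (link M)) (2 * q ^ k * (q - 1)).
  have [alpha [U [a0 dU lE]]] := link_small lt (link_support dM tM).
  rewrite -dU -card_rV_vspace; apply: leq_trans (card_le_weight (link M)).
  by apply: subset_leq_card; apply/subsetP => v vU; rewrite inE /= lE vU mulr1.
have : (0 < q ^ k)%N by rewrite expn_gt0; lia.
rewrite expnS; move: q1 ge; set X := (q ^ k)%N; move: (q) (weight _) => Q W.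
move=> H1 H2 H3; have [b bE] : exists b, Q = (b + 2)%N by exists (Q - 2)%N; lia.
by move: H2; subst Q; rewrite (_ : b + 2 - 1 = b + 1)%N; lia.
Qed.

Lemma dimS W : S W -> \dim W = j.+1. Proof. exact: val_on_dim. Qed.

(* Any two j-spaces of U are joined by a chain of j-spaces of U in which two
   consecutive ones share some M, so that c takes the same value on them. *)
Lemma single_space (U : {vspace V}) : \dim U = k.+1 ->
  (forall M, \dim M = j -> (0 < through S M)%N ->
     exists2 alpha, alpha != 0 & forall v, link M v = alpha * (v \in U)%:R) ->
  exists alpha (kappa : pgspace F n k), c = alpha *: space_word p j kappa.
Proof.
move=> dU HU.
have dUk : \dim U == k.+1 by rewrite dU.
have tM M W : S W -> (M <= W)%VS -> (0 < through S M)%N.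
  by move=> SW MW; apply/throughP; exists W.
(* Write W = M + <v>. Then v lies in U because [link M] is nonzero there, and M lies in U because
   [link M] is constant on M and 0 is in U. *)
have SU W : S W -> (W <= U)%VS.
  move=> SW; have [|M [_ MW dM]] := @intermediate_vspace F _ 0%VS W j (sub0v _).
    by rewrite dimv0 (dimS SW) leqnSn.
  have [a' a0 lE] := HU M dM (tM _ _ SW MW).
  have mem v : link M v != 0 -> v \in U.
    by rewrite lE; case: (v \in U); rewrite // mulr0 eqxx.
  have [v vM WE] := link_neq0 dM SW MW.
  rewrite WE subv_add -memvE mem ?andbT; last first.
    by rewrite link_notin // -WE (Fp_embed_eq0 p_char).
  by apply/subvP => x xM; apply: mem; rewrite link_in // lE mem0v mulr1.
have step M W W1 : \dim M = j -> (M <= W)%VS -> (M <= W1)%VS -> \dim W = j.+1 ->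
    S W1 -> (W <= U)%VS -> val_on c W = val_on c W1.
  move=> dM MW MW1 dW SW1 WU; apply: (Fp_embed_inj p_char).
  have [a' a0 lE] := HU M dM (tM _ _ SW1 MW1).
  have embE W' : (M <= W')%VS -> \dim W' = j.+1 -> (W' <= U)%VS ->
      emb (val_on c W') = a'.
    move=> MW' dW' W'U; have [|v vW vM] := @exists_notin F _ M W'; first by rewrite dM dW'.
    have WE : (M + <[v]>)%VS = W' by apply: add_line_eq; rewrite ?dM.
    by rewrite -WE -link_notin // lE (subvP W'U) // mulr1.
  by rewrite (embE W MW dW WU) (embE W1 MW1 (dimS SW1) (SU _ SW1)).
have [W0 SW0|S0] := pickP S; last first.
  exists 0, (Sub U dUk); apply/ffunP => lam; rewrite scale0r ffunE.
  by apply/eqP; have := S0 (val lam); rewrite /= val_on_val => /negbFE.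
have all W : \dim W = j.+1 -> (W <= U)%VS -> val_on c W = val_on c W0.
  have [d] := ubnP (j.+1 - \dim (W :&: W0))%N; elim: d => // d IH in W * => dI dW WU.
  have [->//|WW0] := eqVneq W W0.
  have /subvPn[x xW0 xW] : ~~ (W0 <= W)%VS.
    by apply: contraNN WW0 => W0W; rewrite eq_sym eqEdim W0W (dimS SW0) dW leqnn.
  have dcap : (\dim (W :&: W0) <= j)%N.
    rewrite -ltnS -dW ltn_neqAle dimvS ?capvSl // andbT.
    apply: contraNN WW0 => /eqP E.
    have /eqP WE : (W :&: W0 == W)%VS by rewrite eqEdim capvSl E leqnn.
    by rewrite eqEdim (dimS SW0) dW leqnn andbT -WE capvSr.
  (* Replace W by M + <x>, where M contains W :&: W0 and x lies in W0 outside W: it shares M with W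
     and meets W0 in a larger space. *)
  have [|M [IM MW dM]] := @intermediate_vspace F _ (W :&: W0)%VS W j (capvSl _ _).
    by rewrite dcap dW leqnSn.
  have xM : x \notin M by apply: contraNN xW; apply: (subvP MW).
  have dW1 : \dim (M + <[x]>) = j.+1 by rewrite dim_add_line ?dM.
  have W1U : (M + <[x]> <= U)%VS.
    by rewrite subv_add (subv_trans MW WU) -memvE (subvP (SU _ SW0)).
  have E1 : val_on c (M + <[x]>)%VS = val_on c W0.
    apply: IH => //; rewrite -ltnS; apply: leq_trans dI.
    have : (\dim ((W :&: W0) + <[x]>) <= \dim ((M + <[x]>) :&: W0))%N.
      apply: dimvS; rewrite subv_cap addvS //= subv_add capvSr -memvE.
      exact: xW0.
    have xI : x \notin (W :&: W0)%VS by rewrite memv_cap negb_and xW.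
    by rewrite (dim_add_line xI); apply: ltn_sub2l.
  rewrite -E1; apply: (step M) => //; first exact: addvSl.
  by rewrite inE /= E1.
exists (val_on c W0), (Sub U dUk); apply/ffunP => lam; rewrite !ffunE SubK.
rewrite -val_on_val; have [lU|lU] := boolP (val lam <= U)%VS.
  by rewrite (all _ (eqP (valP lam)) lU) [RHS]mulr1.
rewrite [RHS]mulr0; apply/eqP; apply: contraNT lU; exact: SU.
Qed.

(** Counting through 0 bounds the vectors on the support by B + 1. This forces every [link M] to
    have weight below B, hence to be a multiple of one subspace, and two different subspaces would
    cover more than B + 1 vectors. *)
Lemma small_word : (0 < k)%N ->
  (wt c)%:R * (q%:R ^+ j.+1 - 1) < 2 * q%:R ^+ k * (q%:R - 1) * gauss q k j
    ?<= if (0 < j)%N ->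
  exists alpha (kappa : pgspace F n k), c = alpha *: space_word p j kappa.
Proof.
move=> k0 small.
have q1 : (1 < q)%N := finNzRing_gt1 F.
have g0 : 0 < gauss q k j := gauss_gt0 q1 (ltnW j_lt_k).
pose B := (2 * q ^ k * (q - 1))%N.
have BE : B%:R = 2 * q%:R ^+ k * (q%:R - 1) :> rat.
  by rewrite /B !natrM natrX natrB // ltnW.
(* For the zero word any (k + 1)-dimensional space will do. *)
have [Ufull [_ _ dUfull]] : exists M' : {vspace V},
    [/\ (0 <= M')%VS, (M' <= {:V})%VS & \dim M' = k.+1].
  by apply: intermediate_vspace (sub0v _) _; rewrite dimv0 dim_rV; lia.
have [W0 SW0|S0] := pickP S; last first.
  by apply: (single_space dUfull) => M _ /throughP[W]; rewrite S0.
have t0 : (0 < through S 0%VS)%N by apply/throughP; exists W0 => //; apply: sub0v.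
have line_ge (v : V) : v \notin 0%VS -> (0 < through S (0 + <[v]>))%N ->
    gauss q k j <= (through S (0 + <[v]>))%:R.
  move=> v0 tv; have := @gauss_le_through F _ j k S dimS j_lt_k reach_codeword (0 + <[v]>)%VS.
  by rewrite dim_add_line // dimv0 !subSS !subn0; apply.
have := le_through dimS (leq_trans (eq_leq (dimv0 V)) (leq0n j)) t0 line_ge.
rewrite dimv0 expr0 -wt_through => leY.
have leB : (wt c)%:R * (q%:R ^+ j.+1 - 1) <= B%:R * gauss q k j by rewrite BE (lteifW small).
have YB : (reach S 0%VS <= B.+1)%N.
  rewrite -(ler_nat rat) -natr1 -lerBlDr -(ler_pM2r g0).
  exact: le_trans leY leB.
(* A weight of at least B would give [reach] at least B + 1 at M, hence at 0, so the count through 0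
   would be tight. For j = 0 the strict hypothesis excludes this. *)
have wB M : \dim M = j -> (0 < through S M)%N -> (weight (link M) < B)%N.
  move=> dM tM; rewrite ltnNge; apply/negP => BW.
  have BrM : (B < reach S M)%N := leq_ltn_trans BW (weight_lt_reach dM tM).
  have BY : (B < reach S 0%VS)%N := leq_trans BrM (reachS _ (sub0v M)).
  have BY' : B%:R * gauss q k j <= ((reach S 0%VS)%:R - 1) * gauss q k j.
    by rewrite ler_pM2r // lerBrDr natr1 ler_nat.
  have [j0|jpos] := posnP j.
    move: small; have -> : (0 < j)%N = false by rewrite j0.
    rewrite /= -BE ltNge => /negP; apply; exact: le_trans BY' leY.
  have [|v vM v0] := @exists_notin F _ 0%VS M; first by rewrite dimv0 dM.
  have L0 : (0 + <[v]> <= M)%VS by rewrite add0v -memvE.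
  have tL : (0 < through S (0 + <[v]>))%N := leq_trans tM (throughS _ L0).
  have dL : \dim (0 + <[v]>) = 1%N by rewrite dim_add_line // dimv0.
  (* For j > 0, a line <v> in M has [reach] above B >= q^(k+1), so strictly more than the minimal
     number of spaces pass through it, and the count through 0 becomes strict. *)
  have lt : gauss q k j < (through S (0 + <[v]>))%:R.
    have pos : (0 : rat) < q%:R ^+ j.+1 - q%:R ^+ 1.
      by rewrite subr_gt0 ltr_eXn2l ?ltr1n.
    have g2 : 0 < gauss q k.-1 j.-1.
      by apply: gauss_gt0 => //; rewrite -!subn1 leq_sub2r // ltnW.
    have := @le_through F _ j S dimS (0 + <[v]>)%VS (gauss q k.-1 j.-1).
    rewrite dL => /(_ jpos tL); have E := gauss_step q1 k.-1 j.-1 1%N.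
    rewrite (prednK jpos) (prednK k0) !addn1 in E.
    move=> H; rewrite -(ltr_pM2r pos) E; apply: lt_le_trans (H _); last first.
      move=> u uL tu.
      have := @gauss_le_through F _ j k S dimS j_lt_k reach_codeword (0 + <[v]> + <[u]>)%VS.
      by rewrite dim_add_line // dL !subSS !subn1; apply.
    rewrite ltr_pM2r // ltrD2r -natrX ltr_nat.
    apply: leq_trans (leq_trans BrM (reachS _ L0)).
    have : (0 < q ^ k)%N by rewrite expn_gt0 ltnW.
    by rewrite ltnS /B expnS; apply: mul_le_gap.
  have := lt_through dimS (leq_trans (eq_leq (dimv0 V)) (leq0n j)) t0 line_ge v0 tL lt.
  rewrite dimv0 expr0 -wt_through => ltY.
  by have := lt_le_trans (le_lt_trans BY' ltY) leB; rewrite ltxx.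
have inY M v : \dim M = j -> (0 < through S M)%N -> link M v != 0 ->
    (0 < through S (0 + <[v]>))%N.
  move=> dM tM lv; apply: leq_trans (link_through dM tM lv) _.
  by apply/throughS/addvS/subvv/sub0v.
have [M1 [_ M1W dM1]] : exists M' : {vspace V},
    [/\ (0 <= M')%VS, (M' <= W0)%VS & \dim M' = j].
  by apply: intermediate_vspace (sub0v _) _; rewrite dimv0 (dimS SW0) leqnSn.
have tM1 : (0 < through S M1)%N by apply/throughP; exists W0.
have [a1 [U1 [a10 dU1 lE1]]] := link_small (wB _ dM1 tM1) (link_support dM1 tM1).
apply: (single_space dU1) => M dM tM.
have [aM [U [aM0 dU lE]]] := link_small (wB _ dM tM) (link_support dM tM).
suff -> : U1 = U by exists aM.
apply/eqP; rewrite eqEdim dU dU1 leqnn andbT; apply/negPn/negP => /subvPn[x xU1 xU].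
have dI : (\dim (U1 :&: U) <= k)%N.
  rewrite -ltnS -dU1 ltn_neqAle dimvS ?capvSl // andbT.
  apply: contraNN xU => /eqP E.
  have /eqP UE : (U1 :&: U == U1)%VS by rewrite eqEdim capvSl E leqnn.
  by move: xU1; rewrite -UE memv_cap => /andP[].
have : (#|[predU U1 & U]| <= B.+1)%N.
  apply: leq_trans YB; apply: subset_leq_card; apply/subsetP => v; rewrite !inE.
  case/orP => vU; first by apply: (inY M1) => //; rewrite lE1 vU mulr1.
  by apply: (inY M) => //; rewrite lE vU mulr1.
have := cardUI (mem U1) (mem U); rewrite !card_rV_vspace dU dU1.
have -> : #|[predI U1 & U]| = (q ^ \dim (U1 :&: U))%N.
  by rewrite -card_rV_vspace; apply: eq_card => v; rewrite !inE memv_cap.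
have : (q ^ \dim (U1 :&: U) <= q ^ k)%N by rewrite leq_exp2l.
have : (1 < q ^ k)%N by rewrite -(exp1n k) ltn_exp2r.
rewrite /B expnS; move: q1; set X := (q ^ k)%N.
by move=> Q1 X1 DX CD CB; apply: (union_too_big Q1 X1 DX _ CB); rewrite CD.
Qed.

End Codes.

(** * The hull *)

(** This handles the default value of [min_weight]. Apply the counting to the set of all j-spaces,
    where [reach] is q^(n+1) >= q^(k+2). *)
Lemma card_pgspace_gt (F : finFieldType) (n j k : nat) : (j < k)%N -> (k < n)%N ->
  weight_bound #|F| j k < #|pgspace F n j|%:R.
Proof.
move=> jk kn; set q := #|F|.
have q1 : (1 < q)%N := finNzRing_gt1 F.
pose S := [pred W : {vspace 'rV[F]_n.+1} | \dim W == j.+1].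
have dS W : S W -> \dim W = j.+1 by move/eqP.
have thr (M : {vspace 'rV[F]_n.+1}) : (\dim M <= j.+1)%N -> (0 < through S M)%N.
  move=> dM; have [|W [MW _ dW]] := @intermediate_vspace F _ M _ j.+1 (subvf M).
    by rewrite dM dim_rV; lia.
  by apply/throughP; exists W; rewrite // /= dW.
have reachE (M : {vspace 'rV[F]_n.+1}) : (\dim M <= j)%N -> reach S M = (q ^ n.+1)%N.
  move=> dM; rewrite -card_rV; apply: eq_card => v; rewrite !inE thr //.
  have [vM|vM] := boolP (v \in M); first by rewrite (addv_idPl _) -?memvE // leqW.
  by rewrite dim_add_line.
have rge (M : {vspace 'rV[F]_n.+1}) : \dim M = j -> (0 < through S M)%N ->
    (q ^ k.+1 <= reach S M)%N.
  by move=> dM _; rewrite reachE ?dM // leq_exp2l // ltnS ltnW.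
have g0 : 0 < gauss q k j by apply: gauss_gt0 => //; apply: ltnW.
have := @le_through F _ j S dS 0%VS (gauss q k j).
rewrite reachE ?dimv0 // expr0 => H; rewrite -(ltr_pM2r (expq_gt1 q1 (ltn0Sn j))) weight_boundE //.
have -> : #|pgspace F n j| = through S 0%VS.
  rewrite card_sig; apply: eq_card => W; rewrite !inE sub0v andbT; exact: erefl.
apply: lt_le_trans (H _ _ _) => //; last first.
- move=> v v0 tv; have := @gauss_le_through F _ j k S dS jk rge (0 + <[v]>)%VS.
  by rewrite dim_add_line // dimv0 !subSS !subn0; apply.
- by apply: thr; rewrite dimv0.
rewrite ltr_pM2r //.
have -> : 2 * q%:R ^+ k * (q%:R - 1) = (2 * q ^ k * (q - 1))%:R :> rat.
  by rewrite !natrM natrX natrB // ltnW.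
rewrite ltrBrDr natr1 ltr_nat.
have : (q ^ k.+2 <= q ^ n.+1)%N by rewrite leq_exp2l.
have : (0 < q ^ k)%N by rewrite expn_gt0 ltnW.
rewrite !expnS; move: (q) q1 (_ ^ k)%N => Q Q1 X X0.
have [b ->] : exists b, Q = (b + 2)%N by exists (Q - 2)%N; lia.
by rewrite (_ : b + 2 - 1 = b + 1)%N; lia.
Qed.

(** Take a j-space L in kappa and let M be the span of L and a complement of kappa. M is an (n - k +
    j)-space that meets kappa exactly in L, so the scalar product with its word is alpha. *)
Lemma space_word_not_hull (p : nat) (F : finFieldType) (n j k : nat) (alpha : 'F_p)
    (kappa : pgspace F n k) : (j < k)%N -> (k < n)%N ->
  alpha *: space_word p j kappa \in hull p F n j k -> alpha = 0.
Proof.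
move=> jk kn; rewrite !inE => /andP[_ /forall_inP dual0].
pose K := val kappa; have dK : \dim K = k.+1 := eqP (valP kappa).
have [|L [_ LK dL]] := @intermediate_vspace F _ 0%VS K j.+1 (sub0v _).
  by rewrite dimv0 dK; lia.
pose M := (L + K^C)%VS.
have dM : \dim M = (n - k + j).+1.
  rewrite dimv_disjoint_sum ?dimv_compl ?dim_rV ?dK ?dL; first by lia.
  by apply/eqP; rewrite -subv0 -(capv_compl K) capvS.
have KM : (K :&: M)%VS = L.
  apply/esym/eqP; rewrite eqEdim subv_cap LK addvSl /= dL.
  have := dimv_sum_cap K M; rewrite (_ : (K + M)%VS = fullv) ?dim_rV ?dK ?dM; first by lia.
  by apply: subv_anti; rewrite subvf -(addv_complf K) addvS ?subvv ?addvSr.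
have /eqP dM' := dM; have /eqP dL' := dL.
have := dual0 (space_word p j (Sub M dM' : pgspace F n (n - k + j))).
rewrite inE memv_span ?map_f ?mem_enum // => /(_ isT)/eqP <-.
rewrite /dotw (bigD1 (Sub L dL' : pgspace F n j)) //= !ffunE /= LK addvSl !mulr1.
rewrite big1 => [|lam lamL]; first by rewrite addr0 [RHS]mulr1.
rewrite !ffunE.
case lK: (val lam <= K)%VS; last by rewrite scaler0 mul0r.
case lM: (val lam <= M)%VS; last by rewrite mulr0.
case/eqP: lamL; apply: val_inj; apply/eqP; rewrite eqEdim /= -{1}KM subv_cap lK lM.
by rewrite dL (eqP (valP lam)) leqnn.
Qed.

Theorem theorem6p8 (p h q n j k : nat) (F : finFieldType)
    (p_prime : prime p) (h_gt0 : (0 < h)%N) (q_def : q = (p ^ h)%N)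
    (F_card : #|F| = q) (j_lt_k : (j < k)%N) (k_lt_n : (k < n)%N) :
  (forall c : words p F n j, c \in code p F n j k ->
     (wt c)%:R < weight_bound q j k ?<= if (0 < j)%N ->
     exists (alpha : 'F_p) (kappa : pgspace F n k),
       c = alpha *: space_word p j kappa)
  /\ weight_bound q j k < (min_weight (hull p F n j k))%:R ?<= if (j == 0)%N.
Proof.
have p_char : p \in [pchar F] by apply: (card_finPcharP (n := h)); rewrite // F_card.
rewrite -F_card.
have small c : c \in code p F n j k ->
    (wt c)%:R < weight_bound #|F| j k ?<= if (0 < j)%N ->
    exists (alpha : 'F_p) (kappa : pgspace F n k), c = alpha *: space_word p j kappa.
  move=> /code_sum[a aE] lt; apply: (small_word p_char j_lt_k k_lt_n aE).
    exact: leq_ltn_trans (leq0n j) j_lt_k.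
  rewrite -weight_boundE ?finNzRing_gt1 // lteif_pM2r //.
  by rewrite expq_gt1 ?finNzRing_gt1.
split=> //; rewrite /min_weight; elim/big_ind: _ => [|x y Hx Hy|c /andP[cH c0]].
- exact/lteifS/card_pgspace_gt.
- by rewrite /minn; case: ifP.
(* A hull word violating the bound is a multiple of a k-space, hence zero. *)
apply: contraNT c0 => Hc.
have : (wt c)%:R < weight_bound #|F| j k ?<= if (0 < j)%N.
  by rewrite lt0n lteifNE.
have cC : c \in code p F n j k by move: cH; rewrite !inE => /andP[].
case/(small c cC) => alpha [kappa cE].
by rewrite cE in cH *; rewrite (space_word_not_hull j_lt_k k_lt_n cH) scale0r.
Qed.
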